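(* Let $H$ be a non-abelian simple subgroup of a finite simple group $G$ and let $i\colon H\hookrightarrow G$ be the inclusion. Then $i$ is a localization if and only if the following three conditions are satisfied: (1) The inclusion $i\colon H\hookrightarrow G$ extends to an inclusion $i\colon \mathrm{Aut}(H)\hookrightarrow \mathrm{Aut}(G)$. (2) Any subgroup of $G$ which is isomorphic to $H$ is conjugate to $H$ in $\mathrm{Aut}(G)$. (3) The centralizer $C_{\mathrm{Aut}(G)}(H)$ is trivial.
   Context: A group homomorphism $\varphi\colon H\to G$ is a localization if there is a localization functor $(L,\eta)$ on groups (a functor $L$ with a natural transformation $\eta\colon \mathrm{Id}\to L$ such that $\eta_{LX}$ and $L(\eta_X)\colon LX\to LLX$ coincide and are isomorphisms for every group $X$) with $G=LH$ and $\varphi=\eta_H$; equivalently, if composition with $\varphi$ induces a bijection $\varphi^*\colon \mathrm{Hom}(G,G)\to \mathrm{Hom}(H,G)$. A non-abelian simple group $X$ is identified with a subgroup of $\mathrm{Aut}(X)$ via the injection $c\colon X\to\mathrm{Aut}(X)$, $g\mapsto c_g$, where $c_g(x)=gxg^{-1}$. Condition (1) means that there is an injective homomorphism $\mathrm{Aut}(H)\to\mathrm{Aut}(G)$, again denoted $i$, with $i\circ c=c\circ i$ as maps $H\to \mathrm{Aut}(G)$. Two subgroups $H,H'$ of $G$ are conjugate in $\mathrm{Aut}(G)$ if there is $\alpha\in\mathrm{Aut}(G)$ with $\alpha(H')=H$. The centralizer $C_{\mathrm{Aut}(G)}(H)$ is the centralizer of $c(H)$ in $\mathrm{Aut}(G)$,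 i.e. the group of automorphisms of $G$ fixing $H$ pointwise. *)

(* Defs.v *)
From HB Require Import structures.
From mathcomp Require Import all_boot all_fingroup.

Set Implicit Arguments.
Unset Strict Implicit.
Unset Printing Implicit Defensive.

Local Open Scope group_scope.

(* [groupType] is the type of all groups, finite or not; its decidable equality
   and choice operator are available on every type classically.  Homomorphisms
   are compared pointwise, hence the extensionality clause below. *)
Record groupFunctor := GroupFunctor {
  functor_obj :> groupType -> groupType;
  functor_map : forall X Y : groupType,
    {multiplicative X -> Y} -> {multiplicative functor_obj X -> functor_obj Y};
  functor_map_ext : forall (X Y : groupType) (f g : {multiplicative X -> Y}),
    f =1 g -> functor_map f =1 functor_map g;
  functor_map_id : forall X : groupType,
    functor_map (idfun : {multiplicative X -> X}) =1 idfun;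
  functor_map_comp : forall (X Y Z : groupType)
      (g : {multiplicative Y -> Z}) (f : {multiplicative X -> Y}),
    functor_map (g \o f : {multiplicative X -> Z})
      =1 functor_map g \o functor_map f
}.

Record coaugmentation (L : groupFunctor) := Coaugmentation {
  coaug :> forall X : groupType, {multiplicative X -> L X};
  coaug_natural : forall (X Y : groupType) (f : {multiplicative X -> Y}),
    coaug Y \o f =1 functor_map L f \o coaug X
}.

Definition localization_functor (L : groupFunctor) (eta : coaugmentation L) :
    Prop :=
  forall X : groupType,
    [/\ eta (L X) =1 functor_map L (eta X),
        bijective (eta (L X)) & bijective (functor_map L (eta X))].

(* "G = L H and phi = eta_H" is understood up to an isomorphism theta, since
   the values of a functor only matter up to isomorphism. *)
Definition is_localization (H G : groupType) (phi : {multiplicative H -> G}) :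
    Prop :=
  exists (L : groupFunctor) (eta : coaugmentation L),
    localization_functor eta /\
    exists theta : {multiplicative L H -> G},
      bijective theta /\ theta \o eta H =1 phi.

Section Inclusion.

Variables (gT : finGroupType) (H G : {group gT}) (sHG : H \subset G).

Definition subg_incl (x : subg_of H) : subg_of G :=
  Subg (subsetP sHG (sgval x) (subgP x)).

Fact subg_inclM : {morph subg_incl : x y / x * y}.
Proof. by move=> x y; apply: val_inj. Qed.

HB.instance Definition _ :=
  isMultiplicative.Build (subg_of H) (subg_of G) subg_incl subg_inclM.

End Inclusion.

(* [conj_aut H x] is y |-> x^-1 * y * x, and permutations compose from left to
   right, so [conj_aut] is a homomorphism; it is g |-> c_(g^-1).  Replacing c_g
   by c_(g^-1) on both sides does not change the condition over all x in H. *)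
Definition extends_to_Aut (gT : finGroupType) (H G : {group gT}) : Prop :=
  exists j : {morphism Aut H >-> {perm gT}},
    [/\ 'injm j, j @* Aut H \subset Aut G
      & {in H, forall x, j (conj_aut H x) = conj_aut G x}].

Definition iso_subgroups_Aut_conjugate (gT : finGroupType) (H G : {group gT}) :
    Prop :=
  forall K : {group gT}, K \subset G -> K \isog H ->
    exists2 a, a \in Aut G & a @: K = H.

(* Main.v *)
Require Import Defs.
From HB Require Import structures.
From mathcomp Require Import all_boot all_fingroup all_solvable.
From mathcomp Require Import boolp.

(** The theorem splits into a categorical half, valid for all groups, and a
    finite half.

    Categorical half: phi : H -> G is a localization iff composition with phi
    is a bijection Hom(G, G) -> Hom(H, G) ([localization_unique_extension] and
    [unique_extension_localization]).  If L is a localization functor with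
    L H = G, then f : H -> L H extends along eta_H to (eta_{LH})^-1 o L f, and
    u : L H -> L H is determined by L (u o eta_H) because eta_{LH} = L eta_H.
    Conversely, given the bijection, one has to produce a functor on all groups.
    The usual transfinite construction is avoided by working inside powers of G.
    Restriction along phi is also a bijection Hom(G, P) -> Hom(H, P) for every
    power P of G, so subgroups of P closed under taking extensions along phi are
    stable under intersection.  Let L X be the least such subgroup of
    G^{Hom(X, G)} containing the image of the evaluation map.  The key facts
    about L X are proved by induction over the generation of this hull; at the
    step that adjoins the values of an extension u : G -> P, the claim is an equality
    of two homomorphisms G -> G which agree on phi(H), hence on G.  In this way
    a homomorphism L X -> G is the coordinate at its restriction to X
    ([reflection_dual_eval]), which gives idempotence, and an element of L H is
    determined by its coordinate at phi ([reflection_value]), which gives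
    L H = G.

    Finite half: since G and H are simple, every homomorphism H -> G or G -> G
    is trivial or injective, so the bijection says that every embedding of H
    into G is the restriction of exactly one automorphism of G
    ([unique_extension_automorphic]).  For the equivalence of this with the
    three conditions ([unique_automorphic_extensionP]), uniqueness makes the
    extension of automorphisms of H multiplicative, giving (1); extending an
    isomorphism from H to K gives (2); an automorphism centralizing the inner
    automorphisms by H fixes H pointwise, giving (3).  Conversely, an embedding
    f : H -> G is moved by (2) to an automorphism b of H, and j(b) restricts to
    b on H because conjugation by j(b) permutes the inner automorphisms of G by
    elements of H as b permutes H; uniqueness is (3). *)

Set Implicit Arguments.
Unset Strict Implicit.
Unset Printing Implicit Defensive.

Local Open Scope group_scope.

(** * Localizations and unique extension of homomorphisms *)

Lemma multiplicative_eq (X Y : groupType) (f g : {multiplicative X -> Y}) :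
  f =1 g -> f = g.
Proof.
case: f g => [f [[fM]]] [g [[gM]]] /= /funext eq_fg.
by case: g / eq_fg gM => gM; rewrite (Prop_irrelevance fM gM).
Qed.

Lemma multiplicative1 (X Y : groupType) (f : {multiplicative X -> Y}) : f 1 = 1.
Proof. by apply: (mulgI (f 1)); rewrite -gmulfM !mulg1. Qed.

Lemma multiplicativeV (X Y : groupType) (f : {multiplicative X -> Y}) :
  {morph f : x / x^-1}.
Proof.
move=> x; apply: (mulgI (f x)).
by rewrite -gmulfM !mulgV multiplicative1.
Qed.

Definition unique_extension (H G : groupType)
    (phi : {multiplicative H -> G}) :=
  (forall f : {multiplicative H -> G},
     exists u : {multiplicative G -> G}, u \o phi =1 f) /\
  (forall u v : {multiplicative G -> G}, u \o phi =1 v \o phi -> u =1 v).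

(** Up to the isomorphism of G with L H, the extension of f is L f followed by
    the inverse of eta_{LH}.  For uniqueness, naturality and eta_{LH} = L eta_H
    give eta_{LH} o u = L u o L eta_H = L (u o eta_H), and eta_{LH} is
    injective. *)
Lemma localization_unique_extension (H G : groupType)
    (phi : {multiplicative H -> G}) :
  is_localization phi -> unique_extension phi.
Proof.
case=> L [eta [etaL [theta [theta_bij thetaE]]]].
have [thetaV thetaK thetaVK] := theta_bij.
have [eta_ext [etaV etaK etaVK] _] := etaL H.
have thetaVM := can2_gmulfM thetaK thetaVK.
have etaVM := can2_gmulfM etaK etaVK.
pose thetaVm : {multiplicative G -> L H} :=
  HB.pack thetaV (isMultiplicative.Build _ _ thetaV thetaVM).
pose etaVm : {multiplicative L (L H) -> L H} :=
  HB.pack etaV (isMultiplicative.Build _ _ etaV etaVM).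
split=> [f | u v eq_uv g].
  pose f' : {multiplicative H -> L H} := thetaVm \o f.
  exists (theta \o (etaVm \o (functor_map L f' \o thetaVm))) => h /=.
  rewrite -thetaE /= thetaK.
  by rewrite -[functor_map L f' _](coaug_natural eta f') /= etaK thetaVK.
pose u' : {multiplicative L H -> L H} := thetaVm \o (u \o theta).
pose v' : {multiplicative L H -> L H} := thetaVm \o (v \o theta).
have eq_uv' : u' \o eta H =1 v' \o eta H.
  move=> h /=; congr thetaV.
  by have := eq_uv h; rewrite /= -thetaE.
suff: u' (thetaV g) = v' (thetaV g).
  by rewrite /= thetaVK => /(can_inj thetaVK).
apply: (can_inj etaK).
rewrite [LHS](coaug_natural eta u') [RHS](coaug_natural eta v') /=.
rewrite !eta_ext -[LHS]functor_map_comp -[RHS]functor_map_comp.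
exact: functor_map_ext.
Qed.

(** * The reflection inside powers of the target *)

Section Power.

Variables (I : Type) (G : groupType).

Definition power := I -> G.

HB.instance Definition _ := Choice.on power.

Let powerM (p q : power) : power := fun i => p i * q i.
Let power1 : power := fun=> 1.
Let powerV (p : power) : power := fun i => (p i)^-1.

Fact powerA : associative powerM.
Proof. by move=> p q r; apply/funext => i; apply: mulgA. Qed.
Fact power1M : left_id power1 powerM.
Proof. by move=> p; apply/funext => i; apply: mul1g. Qed.
Fact powerM1 : right_id power1 powerM.
Proof. by move=> p; apply/funext => i; apply: mulg1. Qed.
Fact powerVM : left_inverse power1 powerV powerM.
Proof. by move=> p; apply/funext => i; apply: mulVg. Qed.
Fact powerMV : right_inverse power1 powerV powerM.
Proof. by move=> p; apply/funext => i; apply: mulgV. Qed.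

HB.instance Definition _ :=
  isGroup.Build power powerA power1M powerM1 powerVM powerMV.

Definition proj (i : I) (p : power) : G := p i.

Fact projM i : {morph proj i : p q / p * q}.
Proof. by []. Qed.

HB.instance Definition _ i := isMultiplicative.Build power G (proj i) (projM i).

End Power.

Section Reindex.

Variables (I J : Type) (G : groupType) (s : J -> I).

Definition reindex (p : power I G) : power J G := fun j => p (s j).

Fact reindexM : {morph reindex : p q / p * q}.
Proof. by []. Qed.

HB.instance Definition _ :=
  isMultiplicative.Build (power I G) (power J G) reindex reindexM.

End Reindex.

Section LocalHull.

Variables (H G : groupType) (phi : {multiplicative H -> G}).
Implicit Types X Y Z : groupType.

Definition dual (X : groupType) := {multiplicative X -> G}.

Definition eval (X : groupType) (x : X) : power (dual X) G := fun q => q x.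

Fact evalM (X : groupType) : {morph @eval X : x y / x * y}.
Proof. by move=> x y; apply/funext => q; apply: gmulfM. Qed.

HB.instance Definition _ (X : groupType) :=
  isMultiplicative.Build X (power (dual X) G) (@eval X) (@evalM X).

(** The least subgroup containing the evaluations and closed under extension
    along phi.  The last clause quantifies over homomorphisms u defined on all
    of G instead of extending one from H to G, so that the hull makes sense, and
    its functoriality holds, before anything is known about phi. *)
Inductive local_hull (X : groupType) : power (dual X) G -> Prop :=
| hull_eval x : local_hull (eval x)
| hull_one : local_hull 1
| hull_mul p q : local_hull p -> local_hull q -> local_hull (p * q)
| hull_inv p : local_hull p -> local_hull p^-1
| hull_extend (u : {multiplicative G -> power (dual X) G}) :
    (forall h, local_hull (u (phi h))) -> forall g, local_hull (u g).

Definition hullb X : pred (power (dual X) G) :=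
  fun p => `[< local_hull p >].

Fact hull_group_closed (X : groupType) : group_closed (hullb (X := X)).
Proof.
split=> [|p q /asboolP hp /asboolP hq]; apply/asboolP; first exact: hull_one.
by apply: hull_mul => //; apply: hull_inv.
Qed.

Definition reflection (X : groupType) : Type := {p | hullb (X := X) p}.

HB.instance Definition _ (X : groupType) := SubChoice.on (reflection X).
HB.instance Definition _ (X : groupType) :=
  SubChoice_isSubGroup.Build _ _ (reflection X) (@hull_group_closed X).

Lemma reflection_hull X (p : reflection X) : local_hull (val p).
Proof. exact/asboolP/(valP p). Qed.

Definition Reflection X p (hp : local_hull p) : reflection X :=
  exist _ p (asboolT hp).

Fact corestrict_mulM (K X : groupType)
    (u : {multiplicative K -> power (dual X) G})
    (hu : forall k, local_hull (u k)) :
  {morph (fun k => Reflection (hu k)) : x y / x * y}.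
Proof. by move=> x y; apply: val_inj; rewrite /= gmulfM. Qed.

Definition corestrict (K X : groupType)
    (u : {multiplicative K -> power (dual X) G})
    (hu : forall k, local_hull (u k)) : {multiplicative K -> reflection X} :=
  HB.pack (fun k => Reflection (hu k))
    (isMultiplicative.Build _ _ _ (corestrict_mulM hu)).

Definition precomp (X Y : groupType) (f : {multiplicative X -> Y}) :
    {multiplicative power (dual X) G -> power (dual Y) G} :=
  reindex (fun q : dual Y => q \o f : {multiplicative X -> G}).

(** Reindexing along f sends evaluations to evaluations, and composing with it
    sends a homomorphism on G to a homomorphism on G; this makes the reflection
    a functor. *)
Lemma precomp_hull X Y (f : {multiplicative X -> Y}) p :
  local_hull p -> local_hull (precomp f p).
Proof.
elim=> {p} [x||p q _ hp _ hq|p _ hp|u _ hu g].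
- by have := hull_eval (f x); congr local_hull; apply/funext.
- exact: hull_one.
- exact: hull_mul.
- exact: hull_inv.
- exact: (hull_extend (u := precomp f \o u)).
Qed.

Definition reflection_map (X Y : groupType) (f : {multiplicative X -> Y}) :
    {multiplicative reflection X -> reflection Y} :=
  corestrict (u := precomp f \o val)
    (fun p => precomp_hull f (reflection_hull p)).

Definition reflection_unit (X : groupType) :
    {multiplicative X -> reflection X} :=
  corestrict (u := @eval X) (@hull_eval X).

Lemma reflection_eqP X (p q : reflection X) :
  (forall r, val p r = val q r) -> p = q.
Proof. by move=> eq_pq; apply/val_inj/funext. Qed.

Fact reflection_map_ext (X Y : groupType) (f g : {multiplicative X -> Y}) :
  f =1 g -> reflection_map f =1 reflection_map g.
Proof. by move=> /multiplicative_eq->. Qed.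

Fact reflection_map_id X :
  reflection_map (idfun : {multiplicative X -> X}) =1 idfun.
Proof.
move=> p; apply: reflection_eqP => r /=; congr (val p _).
exact: multiplicative_eq.
Qed.

Fact reflection_map_comp (X Y Z : groupType) (g : {multiplicative Y -> Z})
    (f : {multiplicative X -> Y}) :
  reflection_map (g \o f : {multiplicative X -> Z})
    =1 reflection_map g \o reflection_map f.
Proof.
move=> p; apply: reflection_eqP => r /=; congr (val p _).
exact: multiplicative_eq.
Qed.

Definition reflection_functor :=
  GroupFunctor reflection_map_ext reflection_map_id reflection_map_comp.

Fact reflection_unit_natural (X Y : groupType) (f : {multiplicative X -> Y}) :
  reflection_unit Y \o f =1 reflection_map f \o reflection_unit X.
Proof. by move=> x; apply: reflection_eqP. Qed.

Definition reflection_coaug : coaugmentation reflection_functor :=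
  @Coaugmentation reflection_functor reflection_unit reflection_unit_natural.

Hypothesis uniq_phi :
  forall u v : {multiplicative G -> G}, u \o phi =1 v \o phi -> u =1 v.

(** The only homomorphisms from the reflection to G are the coordinates: q and
    the coordinate at its restriction to X agree on evaluations, and two
    homomorphisms to G cannot come apart on an extension along phi.  Letting q
    vary, this is the equality of the two canonical maps from the reflection to
    its own reflection. *)
Lemma reflection_dual_eval X (q : dual (reflection X)) (p : reflection X) :
  q p = val p (q \o reflection_unit X : {multiplicative X -> G}).
Proof.
suff hq p' : local_hull p' -> forall hp : local_hull p',
    q (Reflection hp) = p' (q \o reflection_unit X : {multiplicative X -> G}).
  rewrite -(hq _ (reflection_hull p) (reflection_hull p)).
  by congr (q _); apply: val_inj.
elim=> {p p'} [x||p1 p2 hp1 IH1 hp2 IH2|p1 hp1 IH1|u hu IH g] hp.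
- by congr (q _); apply: val_inj.
- transitivity (q 1); last by rewrite multiplicative1.
  by congr (q _); apply: val_inj.
- rewrite -[RHS]/(p1 _ * p2 _) -(IH1 hp1) -(IH2 hp2) -gmulfM.
  by congr (q _); apply: val_inj.
- rewrite -[RHS]/(p1 _)^-1 -(IH1 hp1) -multiplicativeV.
  by congr (q _); apply: val_inj.
pose u1 := q \o corestrict (hull_extend hu).
pose u2 := proj (q \o reflection_unit X : {multiplicative X -> G}) \o u.
transitivity (u1 g); first by congr (q _); apply: val_inj.
by apply: (uniq_phi (u := u1) (v := u2)) => h; apply: IH.
Qed.

(** The r-th coordinate, a homomorphism to G extending r along the unit. *)
Definition coord X (r : dual X) : dual (reflection X) := proj r \o val.

Lemma reflection_unit_inj X : injective (reflection_unit (reflection X)).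
Proof.
move=> p p' /(congr1 val) /= eq_ev; apply: reflection_eqP => r.
exact: (congr1 (proj (coord r)) eq_ev).
Qed.

(** The evaluations of elements of the reflection of X are already closed under
    extension along phi: if u has values of this form on phi(H), the element
    whose r-th coordinate is the value of u g at [coord r] lies in the hull, and
    u g is its evaluation. *)
Lemma reflection_unit_surj X (P : reflection (reflection X)) :
  exists p, reflection_unit (reflection X) p = P.
Proof.
suff [p Pp] : exists p, eval p = val P by exists p; apply: val_inj.
elim: (reflection_hull P) => {P} [p||_ _ _ [p <-] _ [q <-]|_ _ [p <-]|u _ IH g].
- by exists p.
- by exists 1; rewrite multiplicative1.
- by exists (p * q); rewrite gmulfM.
- by exists p^-1; rewrite multiplicativeV.
(* The candidate preimage of u g is w g. *)
pose w := reindex (@coord X) \o u.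
have wE h p : eval p = u (phi h) -> w (phi h) = val p.
  move=> eq_p; apply/funext => r.
  exact: (esym (congr1 (proj (coord r)) eq_p)).
have hw : forall g', local_hull (w g').
  apply: hull_extend => h; have [p eq_p] := IH h.
  by have := reflection_hull p; rewrite -(wE _ _ eq_p).
exists (Reflection (hw g)); apply/funext => q.
pose u1 := q \o corestrict hw.
pose u2 := proj q \o u.
apply: (uniq_phi (u := u1) (v := u2)) => h /=.
have [p eq_p] := IH h; rewrite -[RHS](congr1 (proj q) eq_p).
by congr (q _); apply: val_inj; apply: wE.
Qed.

Lemma reflection_localization : localization_functor reflection_coaug.
Proof.
move=> X; have eq_ext : reflection_coaug (reflection X)
    =1 functor_map reflection_functor (reflection_coaug X).
  by move=> p; apply: reflection_eqP => q; apply: reflection_dual_eval.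
have bij : bijective (reflection_coaug (reflection X)).
  have surj P : {p | reflection_unit (reflection X) p = P}.
    by apply/cid/reflection_unit_surj.
  exists (fun P => sval (surj P)) => [p | P]; last exact: (svalP (surj P)).
  exact/reflection_unit_inj/(svalP (surj _)).
by split=> //; apply: eq_bij eq_ext.
Qed.

Hypothesis extend_phi : forall f : {multiplicative H -> G},
  exists u : {multiplicative G -> G}, u \o phi =1 f.

(** This makes the coordinate at phi injective on the reflection of H. *)
Lemma reflection_value (p : reflection H) (f : dual H)
    (u : {multiplicative G -> G}) :
  u \o phi =1 f -> val p f = u (val p phi).
Proof.
move=> uE; elim: (reflection_hull p)
    => {p} [h||p q _ IHp _ IHq|p _ IHp|w _ IH g].
- exact/esym/uE.
- by rewrite multiplicative1.
- by rewrite gmulfM -IHp -IHq.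
- by rewrite multiplicativeV -IHp.
exact: (uniq_phi (u := proj f \o w) (v := u \o (proj phi \o w))).
Qed.

Lemma unique_extension_localization : is_localization phi.
Proof.
exists reflection_functor, reflection_coaug.
split; first exact: reflection_localization.
exists (proj phi \o val : {multiplicative reflection H -> G}); split=> //.
have [e eE] := choice extend_phi.
pose ext g : power (dual H) G := fun f => e f g.
have extM : {morph ext : x y / x * y}.
  by move=> x y; apply/funext => f; apply: gmulfM.
pose ext_m : {multiplicative G -> power (dual H) G} :=
  HB.pack ext (isMultiplicative.Build _ _ ext extM).
(* On phi(H) the map ext is the evaluation, so the closure of the hull under
   extension along phi puts all its values in the hull. *)
have hull_ext : forall g, local_hull (ext_m g).
  apply: hull_extend => h; rewrite [X in local_hull X](_ : _ = eval h).
    exact: hull_eval.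
  by apply/funext => f; apply: eE.
exists (fun g => Reflection (hull_ext g)) => [p | g] /=.
  by apply: reflection_eqP => f; rewrite /= /ext -(reflection_value _ (eE f)).
by apply: (uniq_phi (u := e phi) (v := idfun)) => h; apply: eE.
Qed.

End LocalHull.

(** * Embeddings of simple groups *)

Section SimpleEmbedding.

Variable gT : finGroupType.
Implicit Types G H K : {group gT}.

Lemma simple_injm_or_trivial (rT : finGroupType) G
    (f : {morphism G >-> rT}) :
  simple G -> 'injm f \/ {in G, forall x, f x = 1}.
Proof.
case/simpleP=> _ simG.
have [/trivgP|kerG] := simG _ (ker_normal f); [by left | right=> x Gx].
by apply: (@mker _ _ _ f); rewrite kerG.
Qed.

Lemma nonabelian_simple_cent1 G : simple G -> ~~ abelian G -> 'C_G(G) = 1.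
Proof.
case/simpleP=> _ simG nabG.
have [// | ZG] := simG _ (center_normal G).
by case/negP: nabG; rewrite /abelian -{1}ZG subsetIr.
Qed.

Lemma conj_aut_in_Aut G x : conj_aut G x \in Aut G.
Proof. exact: Aut_aut. Qed.

Lemma conj_aut_inj G :
  simple G -> ~~ abelian G -> {in G &, injective (conj_aut G)}.
Proof.
move=> simG nabG x y Gx Gy eq_xy; have nGG := subsetP (normG G).
suff /set1P xy1 : x * y^-1 \in [set 1] by rewrite -(mulgKV y x) xy1 mul1g.
rewrite -[[set 1]](nonabelian_simple_cent1 simG nabG) inE groupM ?groupV //=.
rewrite -ker_conj_aut; apply/kerP; first by rewrite nGG // groupM ?groupV.
by rewrite morphM ?morphV ?nGG ?groupV //= eq_xy mulgV.
Qed.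

Lemma conj_autJ G x a : x \in G -> a \in Aut G ->
  conj_aut G x ^ a = conj_aut G (a x).
Proof.
move=> Gx Aa; have AV : a^-1 \in Aut G by rewrite groupV.
apply: (@eq_Aut _ G); rewrite ?groupJ ?conj_aut_in_Aut // => y Gy.
have Gy' : a^-1 y \in G by apply: Aut_closed AV _ Gy.
rewrite conj_autE ?(Aut_closed Aa) // !permM conj_autE //.
by have := morphJ (autm_morphism Aa) Gy' Gx; rewrite /= !autmE permKV.
Qed.

Definition unique_automorphic_extension (H G : {group gT}) :=
  (forall f : {morphism H >-> gT}, 'injm f -> f @* H \subset G ->
     exists2 a, a \in Aut G & {in H, a =1 f}) /\
  (forall a b : {perm gT}, a \in Aut G -> b \in Aut G ->
     {in H, a =1 b} -> a = b).

(** Uniqueness makes the choice of extensions multiplicative, and makes the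
    extension of an inner automorphism of H inner. *)
Lemma unique_automorphic_extends_to_Aut G H : H \subset G ->
  unique_automorphic_extension H G -> extends_to_Aut H G.
Proof.
move=> sHG [extA uniqA]; have domG := subsetP sHG.
pose j (b : {perm gT}) : {perm gT} :=
  odflt 1 [pick a in Aut G | [forall x in H, a x == b x]].
have jP b : b \in Aut H -> j b \in Aut G /\ {in H, j b =1 b}.
  move=> Ab; rewrite /j; case: pickP => [a /andP[Aa /'forall_in_eqP] | no_a] //.
  have [|a Aa /'forall_in_eqP aE] := extA _ (injm_autm Ab).
    by rewrite im_autm.
  by have := no_a a; rewrite /= Aa aE.
have jM : {in Aut H &, {morph j : b c / b * c}}.
  move=> b c Ab Ac; have [[jb jbE] [jc jcE]] := (jP b Ab, jP c Ac).
  have [jbc jbcE] := jP _ (groupM Ab Ac).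
  apply: uniqA; rewrite ?groupM // => x Hx.
  by rewrite jbcE // !permM jbE // jcE ?(Aut_closed Ab).
exists (Morphism jM); split=> [||x Hx].
- apply/injmP => b c Ab Ac eq_j; apply: (eq_Aut Ab Ac) => x Hx.
  by rewrite -(jP b Ab).2 // -(jP c Ac).2 //= [j b]eq_j.
- by apply/subsetP=> _ /morphimP[b _ Ab ->]; case: (jP b Ab).
have [jx jxE] := jP _ (conj_aut_in_Aut H x).
apply: uniqA => //= [|y Hy]; first exact: conj_aut_in_Aut.
by rewrite jxE // !conj_autE ?domG.
Qed.

(** The conjugacy hypothesis turns f into an automorphism b of H after composing
    with an automorphism of G, and the image j b of b does restrict to b on H:
    conjugating inner automorphisms gives c_{j b x} = j (c_x ^ b) = c_{b x}, and
    c is injective on G. *)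
Lemma automorphic_extension_of_Aut G H :
    H \subset G -> simple G -> ~~ abelian G ->
    extends_to_Aut H G -> iso_subgroups_Aut_conjugate H G ->
  forall f : {morphism H >-> gT}, 'injm f -> f @* H \subset G ->
     exists2 a, a \in Aut G & {in H, a =1 f}.
Proof.
move=> sHG simG nabG [j [_ sjG jE]] conjG f injf sfG; have domG := subsetP sHG.
have [|a Aa afH] := conjG (f @* H)%G sfG.
  by rewrite isog_sym sub_isog.
have fG x : x \in H -> f x \in G.
  by move=> Hx; rewrite (subsetP sfG) // mem_morphim.
pose af x := a (f x).
have af_inj : {in H &, injective af}.
  by move=> x y Hx Hy /perm_inj; apply: (injmP injf).
have af_H : af @: H \subset H.
  apply/subsetP=> _ /imsetP[x Hx ->].
  suff: af x \in a @: (f @* H) by rewrite afH.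
  by apply: imset_f; rewrite mem_morphim.
pose b := perm_in af_inj af_H.
have Ab : b \in Aut H.
  rewrite inE perm_in_on; apply/morphicP => x y Hx Hy.
  rewrite !perm_inE ?groupM // /af morphM //.
  by rewrite -(autmE Aa) morphM ?fG.
have Ajb : j b \in Aut G by rewrite (subsetP sjG) // mem_morphim.
have jbE : {in H, j b =1 b}.
  move=> x Hx; have Hbx := Aut_closed Ab Hx.
  apply: (conj_aut_inj simG nabG); rewrite ?(Aut_closed Ajb) ?domG //.
  rewrite -conj_autJ ?domG // -!jE // -conj_autJ // morphJ //.
  exact: conj_aut_in_Aut.
exists (j b * a^-1); first by rewrite groupM ?groupV.
by move=> x Hx; rewrite permM jbE // perm_inE // permK.
Qed.

Lemma unique_automorphic_extensionP G H :
  H \subset G -> simple G -> ~~ abelian G ->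
  unique_automorphic_extension H G <->
  [/\ extends_to_Aut H G, iso_subgroups_Aut_conjugate H G
    & 'C_(Aut G)(conj_aut G @* H) = 1].
Proof.
move=> sHG simG nabG; have domG := subsetP sHG.
have nGG := subsetP (normG G).
split=> [unique | [extAut conjG cent1]].
  have [extA uniqA] := unique; split.
  - exact: unique_automorphic_extends_to_Aut.
  - move=> K sKG; rewrite isog_sym => /isogP[f injf fE].
    have [|a Aa aE] := extA f injf; first by rewrite fE.
    exists a^-1; rewrite ?groupV //.
    rewrite -fE morphimEdom -(eq_in_imset aE) -imset_comp.
    by rewrite (eq_imset _ (g := id)) ?imset_id // => x /=; rewrite permK.
  - apply/trivgP/subsetP=> a /setIP[Aa /centP ca]; apply/set1P.
    apply: uniqA => // x Hx; rewrite perm1.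
    apply: (conj_aut_inj simG nabG); rewrite ?(Aut_closed Aa) ?domG //.
    rewrite -conj_autJ ?domG // /conjg -ca ?mulKg //.
    by apply: mem_morphim => //; rewrite nGG ?domG.
split; first exact: automorphic_extension_of_Aut.
move=> a b Aa Ab eqab.
suff /set1P ab1 : a * b^-1 \in [set 1] by rewrite -(mulgKV b a) ab1 mul1g.
have Aab : a * b^-1 \in Aut G by rewrite groupM ?groupV.
rewrite -[[set 1]]cent1 inE Aab; apply/centP=> _ /morphimP[x _ Hx ->].
apply/esym/commgP/conjg_fixP.
by rewrite conj_autJ ?domG // permM eqab // permK.
Qed.


Lemma subg_of_morph G H (m : {morphism H >-> gT}) : m @* H \subset G ->
  exists f : {multiplicative subg_of H -> subg_of G},
    forall x, val (f x) = m (val x).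
Proof.
move=> smG.
have mG (x : subg_of H) : m (val x) \in G.
  by rewrite (subsetP smG) // mem_morphim ?subgP.
pose f (x : subg_of H) : subg_of G := Subg (mG x).
have fM : {morph f : x y / x * y}.
  by move=> x y; apply: val_inj; rewrite /= morphM ?subgP.
pose fm : {multiplicative subg_of H -> subg_of G} :=
  HB.pack f (isMultiplicative.Build _ _ f fM).
by exists fm.
Qed.

Lemma subg_of_aut G a : a \in Aut G ->
  exists u : {multiplicative subg_of G -> subg_of G},
    forall x, val (u x) = a (val x).
Proof.
move=> Aa; have [|u uE] := @subg_of_morph G G [morphism of autm Aa].
  by rewrite im_autm.
by exists u.
Qed.

Lemma simple_subg_morph G H (f : {multiplicative subg_of H -> subg_of G}) :
  simple H ->
  (forall x, f x = 1) \/
  exists m : {morphism H >-> gT},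
    [/\ 'injm m, m @* H \subset G & forall x, val (f x) = m (val x)].
Proof.
move=> simH; pose m x := val (f (subg H x)).
have mM : {in H &, {morph m : x y / x * y}}.
  by move=> x y Hx Hy; rewrite /m subgM // gmulfM.
have mE x : val (f x) = m (val x) by rewrite /m sgvalK.
have [injm | m1] := simple_injm_or_trivial (Morphism mM) simH.
  right; exists (Morphism mM); split=> //.
  by apply/subsetP=> _ /morphimP[x _ _ ->]; apply: subgP.
by left=> x; apply: val_inj; rewrite mE; apply/m1/subgP.
Qed.

Lemma simple_subg_endo G (u : {multiplicative subg_of G -> subg_of G}) :
  simple G ->
  (forall x, u x = 1) \/
  exists2 a, a \in Aut G & forall x, val (u x) = a (val x).
Proof.
move=> simG; have [|[m [injm smG uE]]] := simple_subg_morph u simG.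
  by left.
have imm : m @* G = G by apply/morphim_fixP.
right; exists (aut injm imm); first exact: Aut_aut.
by move=> x; rewrite autE ?subgP.
Qed.

(** The trivial homomorphism on H extends only trivially, because an
    automorphism of G does not kill the nontrivial group H, and an injective one
    extends only to automorphisms of G.  Hence the two notions differ by a
    homomorphism that extends uniquely in any case. *)
Lemma unique_extension_automorphic G H (sHG : H \subset G) :
    simple G -> simple H ->
  unique_extension (subg_incl sHG) <-> unique_automorphic_extension H G.
Proof.
move=> simG simH.
have [x0 Hx0 ntx0] : exists2 x, x \in H & x != 1.
  by apply/trivgPn; case/simpleP: simH.
pose y0 := Subg Hx0.
have nt_aut a : a \in Aut G -> a x0 != 1.
  move=> Aa; have := morph1 (autm_morphism Aa); rewrite /= autmE => a1.
  by rewrite -[X in _ != X]a1 (inj_eq perm_inj).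
split=> [[ext uniq] | [extA uniqA]]; split.
- move=> m injm smG; have [f fE] := subg_of_morph smG; have [u uE] := ext f.
  have [u1 | [a Aa aE]] := simple_subg_endo u simG.
    case/eqP: ntx0; apply: (injmP injm); rewrite ?group1 // morph1.
    by rewrite -(fE y0) -(uE y0) /= u1.
  by exists a => // x Hx; rewrite -(fE (Subg Hx)) -(uE (Subg Hx)) aE.
- move=> a b Aa Ab eq_ab.
  have [[u uE] [v vE]] := (subg_of_aut Aa, subg_of_aut Ab).
  apply: (eq_Aut Aa Ab) => x Gx; rewrite -(uE (Subg Gx)) -(vE (Subg Gx)).
  congr val; apply: uniq => h; apply: val_inj.
  by rewrite /= uE vE; apply: eq_ab (subgP h).
- move=> f; have [f1 | [m [injm smG mE]]] := simple_subg_morph f simH.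
    pose one_G (_ : subg_of G) : subg_of G := 1.
    have one_GM : {morph one_G : x y / x * y}.
      by move=> x y; rewrite /one_G mulg1.
    pose one_Gm : {multiplicative subg_of G -> subg_of G} :=
      HB.pack one_G (isMultiplicative.Build _ _ one_G one_GM).
    by exists one_Gm => x; rewrite f1.
  have [a Aa aE] := extA m injm smG; have [u uE] := subg_of_aut Aa.
  by exists u => x; apply: val_inj; rewrite mE uE; apply: aE (subgP x).
move=> u v eq_uv; have eq0 := congr1 val (eq_uv y0).
have [u1 | [a Aa aE]] := simple_subg_endo u simG;
  have [v1 | [b Ab bE]] := simple_subg_endo v simG.
- by move=> x; rewrite u1 v1.
- case/eqP: (nt_aut b Ab).
  by rewrite -[LHS](bE (subg_incl sHG y0)) -[LHS]eq0 /= u1.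
- case/eqP: (nt_aut a Aa).
  by rewrite -[LHS](aE (subg_incl sHG y0)) [LHS]eq0 /= v1.
suff eq_ab : a = b by move=> x; apply: val_inj; rewrite aE bE eq_ab.
apply: uniqA => // x Hx.
by have /(congr1 val) := eq_uv (Subg Hx); rewrite /= aE bE.
Qed.
End SimpleEmbedding.

Theorem theorem1p4 (gT : finGroupType) (G H : {group gT}) (sHG : H \subset G)
    (simpleG : simple G) (simpleH : simple H) (nabH : ~~ abelian H) :
  is_localization (subg_incl sHG) <->
  [/\ extends_to_Aut H G,
      iso_subgroups_Aut_conjugate H G
    & 'C_(Aut G)(conj_aut G @* H) = 1].
Proof.
have nabG : ~~ abelian G by apply: contra nabH; apply: abelianS.
have extP := unique_extension_automorphic sHG simpleG simpleH.
have condP := unique_automorphic_extensionP sHG simpleG nabG.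
split=> [/localization_unique_extension/extP/condP // |].
by move=> /condP/extP[ext uniq]; apply: unique_extension_localization.
Qed.
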